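(* Let $p$ be a prime, $G$ any finite group of order $n$, $N/\mathbb{Q}_p$ a finite Galois extension containing all $n$-th roots of unity, and $\mathbb{Q}_p \subseteq K \subseteq M \subseteq N$ intermediate fields with $M/K$ Galois. Let $F \in \mathrm{Gal}(M/K)$ be a lift of the Frobenius automorphism of the residue fields, and let $J$ be the Jacobson radical of $O_M[G]$. If $r \in J$, then $$c(L_{F,0}(1-r)) \in h_M \cdot \Lambda_G .$$
   Context: $O_M$ is the valuation ring of $M$, $\pi_M$ a uniformizer of $M$, and $O_K/\pi_K O_K = \mathbb{F}_{p^q}$; the lift $F$ of Frobenius satisfies $F(z) \equiv z^{p^q} \pmod{\pi_M O_M}$ for all $z \in O_M$. $M\{G\}$ is the $M$-vector space with basis the conjugacy classes of elements of $G$, and $c : M[G] \to M\{G\}$ is the $M$-linear map sending $\gamma \in G$ to its conjugacy class. For $\sum_{\gamma}\lambda_\gamma \gamma \in M[G]$ put $\hat F(\sum_\gamma \lambda_\gamma \gamma) = \sum_\gamma F(\lambda_\gamma)\gamma^{p^q}$. For $r \in J$ (some power of $r$ lies in $pO_M[G]$), $L_{F,0}(1-r) \in M[G]$ is the $p$-adically convergent series $$L_{F,0}(1-r) = p^q\sum_{m=1}^\infty \frac{r^m}{m} - \sum_{m=1}^\infty \frac{\hat F(r^m)}{m}.$$ $\Lambda_G = O_M[G]/\left(\sum_{x,y\in G} O_M(xy-yx)\right)$, which embeds into $M\{G\}$ via $c$; it is regarded as the $O_M$-submodule $c(O_M[G])$ of $M\{G\}$. The element $h_M \in M$ is defined up to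 multiplication by $O_M^*$ by $h_M O_M = \bigcup_{k\ge 0} O_M\, \pi_M^{p^k}/p^k$; equivalently, if $e$ is the ramification index of $M/\mathbb{Q}_p$ (so $pO_M = \pi_M^e O_M$), then $h_M = \pi_M^{\min_{k\ge 0}(p^k-ke)}$. *)

(* Defs.v *)
From HB Require Import structures.
From mathcomp Require Import all_boot all_order all_algebra.
From mathcomp Require Import all_fingroup all_solvable all_field.

Set Implicit Arguments.
Unset Strict Implicit.
Unset Printing Implicit Defensive.

Import Order.TTheory GRing.Theory Num.Theory.
Local Open Scope ring_scope.

(* Valuations are additive, of rank one, and rational-valued, which is enough *)
(* for the extensions of the p-adic valuation to finite extensions of Q_p.    *)
(* The value [v 0] is irrelevant: 0 is treated as having valuation +oo.       *)
Section Valuation.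
Variable L : fieldType.
Implicit Types (v : L -> rat) (A : {pred L}).

Definition vge v (B : rat) (x : L) : bool := (x == 0) || (B <= v x).
Definition vgt v (B : rat) (x : L) : bool := (x == 0) || (B < v x).

Definition is_valuation v : Prop :=
  (forall x y, x != 0 -> y != 0 -> v (x * y) = v x + v y) /\
  (forall B x y, vge v B x -> vge v B y -> vge v B (x + y)).

Definition vcvg v (u : nat -> L) (l : L) : Prop :=
  forall B : rat, exists m, forall i, (m <= i)%N -> vge v B (u i - l).

Definition vcauchy v (u : nat -> L) : Prop :=
  forall B : rat, exists m, forall i j, (m <= i)%N -> (m <= j)%N ->
    vge v B (u i - u j).

(* [(L, v)] is Q_p with its normalized valuation, presented as the completion *)
(* of rat for the p-adic valuation; this determines it up to a unique         *)
(* isomorphism. The clause on n forces L to have characteristic 0.            *)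
Definition is_padic_field (p : nat) v : Prop :=
  [/\ is_valuation v,
      forall n, (0 < n)%N -> (n%:R : L) != 0 /\ v n%:R = (logn p n)%:R,
      forall (x : L) (B : rat), exists c : rat, vge v B (x - ratr c)
    & forall u : nat -> L, vcauchy v u -> exists l, vcvg v u l].

(* The valuation ring of the subfield A, and its maximal ideal. *)
Definition valring v A : {pred L} := [pred x | (x \in A) && vge v 0 x].
Definition valmax v A : {pred L} := [pred x | (x \in A) && vgt v 0 x].

Definition in_multiples A (a x : L) : Prop := exists2 y, y \in A & x = a * y.

Definition uniformizer v A (pi : L) : Prop :=
  [/\ pi \in A, pi != 0
    & forall x, x \in valmax v A <-> in_multiples (valring v A) pi x].

(* The residue field of A is isomorphic to the finite field k: rho (whose     *)
(* values outside of the valuation ring are irrelevant) is a surjective ring  *)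
(* morphism from the valuation ring to k whose kernel is the maximal ideal.   *)
Definition residue_map v A (k : finFieldType) (rho : L -> k) : Prop :=
  [/\ rho 1 = 1,
      {in valring v A &, {morph rho : x y / x + y}},
      {in valring v A &, {morph rho : x y / x * y}},
      {in valring v A, forall x, (rho x == 0) = (x \in valmax v A)}
    & forall y, exists2 x, x \in valring v A & rho x = y].

Definition residue_field_card v A (s : nat) : Prop :=
  exists k : finFieldType, #|k| = s /\ exists rho : L -> k, residue_map v A rho.

(* h O_A is the union over k of the O_A-submodules generated by               *)
(* pi ^ (p ^ k) / p ^ k.                                                      *)
Definition h_generator v A (p : nat) (pi h : L) : Prop :=
  h \in A /\
  forall x, in_multiples (valring v A) h x <->
    exists k, in_multiples (valring v A) (pi ^+ (p ^ k) / (p ^ k)%:R) x.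

End Valuation.

Section Jacobson.
Variable R : nzRingType.
Implicit Types (A : {pred R}) (I J : R -> Prop).

Definition left_ideal A I : Prop :=
  [/\ forall x, I x -> x \in A,
      I 0,
      forall x y, I x -> I y -> I (x - y)
    & forall a x, a \in A -> I x -> I (a * x)].

Definition maximal_left_ideal A I : Prop :=
  [/\ left_ideal A I, ~ I 1
    & forall J, left_ideal A J -> ~ J 1 -> (forall x, I x -> J x) ->
      forall x, J x -> I x].

(* The Jacobson radical of the subring A of R. *)
Definition jacobson A (r : R) : Prop :=
  r \in A /\ forall I, maximal_left_ideal A I -> I r.

End Jacobson.

(* The group algebra R[G]; an alias of {ffun G -> R} is needed because the    *)
(* latter carries the pointwise product.                                      *)
Definition grpalg (R : nzRingType) (G : finGroupType) : Type := {ffun G -> R}.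

Section GroupAlgebra.
Variables (R : nzRingType) (G : finGroupType).
Local Notation RG := (grpalg R G).
Implicit Types (f g h : RG) (a b : R) (x y : G).

HB.instance Definition _ := GRing.Zmodule.copy RG {ffun G -> R}.

Definition coef f x : R := (f : {ffun G -> R}) x.
Definition grp_elt y : RG := [ffun x => (x == y)%:R].
Definition grp_one : RG := grp_elt 1%g.
Definition grp_mul f g : RG :=
  [ffun x => \sum_y coef f y * coef g (y^-1 * x)%g].
Definition grp_scale a f : RG := [ffun x => a * coef f x].

Lemma grpP f g : coef f =1 coef g -> f = g.
Proof. by move=> fg; apply/ffunP. Qed.

Lemma coefD f g x : coef (f + g) x = coef f x + coef g x.
Proof. by rewrite /coef [LHS]ffunE. Qed.

Lemma coef_mul f g x :
  coef (grp_mul f g) x = \sum_y coef f y * coef g (y^-1 * x)%g.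
Proof. by rewrite /coef [LHS]ffunE. Qed.

Lemma coef_elt y x : coef (grp_elt y) x = (x == y)%:R.
Proof. by rewrite /coef [LHS]ffunE. Qed.

Lemma coef_scale a f x : coef (grp_scale a f) x = a * coef f x.
Proof. by rewrite /coef [LHS]ffunE. Qed.

Fact grp_mulA : associative grp_mul.
Proof.
move=> f g h; apply: grpP => x; rewrite !coef_mul.
under eq_bigr do rewrite coef_mul big_distrr /=.
under [RHS]eq_bigr do rewrite coef_mul big_distrl /=.
rewrite [RHS]exchange_big /=; apply: eq_bigr => y _.
rewrite [RHS](reindex_inj (mulgI y)) /=; apply: eq_bigr => z _.
by rewrite mulKg invMg !mulrA mulgA.
Qed.

Fact grp_mul1l : left_id grp_one grp_mul.
Proof.
move=> f; apply: grpP => x; rewrite coef_mul (bigD1 1%g) //= big1 => [|y ny].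
  by rewrite coef_elt eqxx mul1r addr0 invg1 mul1g.
by rewrite coef_elt (negPf ny) mul0r.
Qed.

Fact grp_mul1r : right_id grp_one grp_mul.
Proof.
move=> f; apply: grpP => x; rewrite coef_mul (bigD1 x) //= big1 => [|y ny].
  by rewrite coef_elt mulVg eqxx mulr1 addr0.
by rewrite coef_elt -eq_mulVg1 (negPf ny) mulr0.
Qed.

Fact grp_mulDl : left_distributive grp_mul +%R.
Proof.
move=> f g h; apply: grpP => x; rewrite coefD !coef_mul -big_split /=.
by apply: eq_bigr => y _; rewrite coefD mulrDl.
Qed.

Fact grp_mulDr : right_distributive grp_mul +%R.
Proof.
move=> f g h; apply: grpP => x; rewrite coefD !coef_mul -big_split /=.
by apply: eq_bigr => y _; rewrite coefD mulrDr.
Qed.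

Fact grp_one_neq0 : grp_one != 0.
Proof.
apply/eqP => /(congr1 (fun f => coef f 1%g)).
by rewrite coef_elt eqxx /coef ffunE; apply/eqP/oner_neq0.
Qed.

HB.instance Definition _ := GRing.Zmodule_isNzRing.Build RG
  grp_mulA grp_mul1l grp_mul1r grp_mulDl grp_mulDr grp_one_neq0.

Fact grp_scaleA a b f : grp_scale a (grp_scale b f) = grp_scale (a * b) f.
Proof. by apply: grpP => x; rewrite !coef_scale mulrA. Qed.

Fact grp_scale1 : left_id 1 grp_scale.
Proof. by move=> f; apply: grpP => x; rewrite coef_scale mul1r. Qed.

Fact grp_scaleDr : right_distributive grp_scale +%R.
Proof. by move=> a f g; apply: grpP => x; rewrite coefD !coef_scale coefD mulrDr. Qed.

Fact grp_scaleDl f : {morph grp_scale^~ f : a b / a + b}.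
Proof. by move=> a b; apply: grpP => x; rewrite coefD !coef_scale mulrDl. Qed.

HB.instance Definition _ := GRing.Zmodule_isLmodule.Build R RG
  grp_scaleA grp_scale1 grp_scaleDr grp_scaleDl.

(* A[G] as a subset of R[G], for a subset A of R. *)
Definition grpalg_over (A : {pred R}) : {pred RG} :=
  [pred f | [forall x, coef f x \in A]].

Definition conjclass : Type := {C : {set G} | C \in classes [set: G]}.
Definition class_elt x : conjclass := Sub (x ^: [set: G])%g (mem_classes (in_setT x)).

(* The free R-module R{G} on the conjugacy classes. *)
Definition classmod : Type := {ffun conjclass -> R^o}.
HB.instance Definition _ := GRing.Lmodule.copy classmod {ffun conjclass -> R^o}.

Definition class_basis (C : conjclass) : classmod := [ffun D => (D == C)%:R].

Definition conj_map f : classmod := \sum_x coef f x *: class_basis (class_elt x).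

(* The image in R{G} of A[G]; for A = O_M this is Lambda_G. *)
Definition Lambda (A : {pred R}) (z : classmod) : Prop :=
  exists2 f, f \in grpalg_over A & z = conj_map f.

(* s is the order p ^ q of the residue field on which F lifts Frobenius. *)
Definition hatF (F : R -> R) (s : nat) f : RG :=
  \sum_x F (coef f x) *: grp_elt (x ^+ s)%g.

End GroupAlgebra.

Section Logarithm.
Variables (L : fieldType) (G : finGroupType) (v : L -> rat) (A : {pred L}).

Definition grp_cvg (u : nat -> grpalg L G) (l : grpalg L G) : Prop :=
  forall x, vcvg v (fun i => coef (u i) x) (coef l x).

(* l is the sum in A[G] of the series of the u m, m >= 1. *)
Definition grp_series_sum (u : nat -> grpalg L G) (l : grpalg L G) : Prop :=
  l \in grpalg_over A /\ grp_cvg (fun k => \sum_(1 <= m < k) u m) l.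

(* Both series converge in A[G] and l is the value of L_{F,0}(1 - r). *)
Definition is_LF0 (F : L -> L) (s : nat) (r l : grpalg L G) : Prop :=
  exists S1 S2 : grpalg L G,
    [/\ grp_series_sum (fun m => m%:R^-1 *: r ^+ m) S1,
        grp_series_sum (fun m => m%:R^-1 *: hatF F s (r ^+ m)) S2
      & l = s%:R *: S1 - S2].

End Logarithm.

(* Main.v *)
From HB Require Import structures.
Require Import Defs.
From mathcomp Require Import all_boot all_order all_algebra.
From mathcomp Require Import all_fingroup all_solvable all_field.
From mathcomp Require Import ring zify.
From mathcomp Require boolp classical_sets.

(** Let chi be the indicator function of a conjugacy class, extended linearly
    to M[G], and let s = p^q. Expanding r^m over the words w of G^m, with
    coefficient lam(w) (a product of coefficients of r) and product g(w), gives
    chi(r^m) as the sum of the lam(w) chi(g(w)); each summand is invariant under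
    rotation of w. A rotation orbit of size d consists of rotations of a power
    x^k of a word x of length d = m/k. If s does not divide k, the orbit
    contributes an integral multiple of s/k, hence of p. If m = s j, the words
    whose period divides j are the powers u^s with u in G^j; they are paired
    with the words of the expansion of hatF(r^j), and the orbit of u = x^k
    contributes a multiple of (lam(x)^(s k) - F(lam(x))^k) / k. Since F(lam(x))
    is congruent to lam(x)^s modulo pi, the binomial formula writes this as a
    combination of the pi^i / i, which belong to h O_M. So the first series
    truncated at s T minus the second one truncated at T is exactly in h Lambda,
    and it remains to let T go to infinity.

    For convergence: the powers of r satisfy a primitive relation with integral
    coefficients; if r^m is its first term with a unit coefficient, the relation
    reads r^m (1 - b r) = 0 mod pi, and 1 - b r is left invertible because r is
    in the Jacobson radical, so r^m = 0 mod pi. *)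

Set Implicit Arguments.
Unset Strict Implicit.
Unset Printing Implicit Defensive.

Import Order.TTheory GRing.Theory Num.Theory.
Local Open Scope ring_scope.

(** * Valuations *)

Section ValuationTheory.
Variables (L : fieldType) (v : L -> rat).
Hypothesis hv : is_valuation v.
Implicit Types (x y : L) (B C : rat).

Lemma val_mul x y : x != 0 -> y != 0 -> v (x * y) = v x + v y.
Proof. by case: hv => + _; apply. Qed.

Lemma vgeD B x y : vge v B x -> vge v B y -> vge v B (x + y).
Proof. by case: hv => _; apply. Qed.

Lemma vge_0 B : vge v B 0.
Proof. by rewrite /vge eqxx. Qed.

Lemma vge_nz B x : x != 0 -> vge v B x = (B <= v x).
Proof. by rewrite /vge => /negPf->. Qed.

Lemma vge_val x : vge v (v x) x.
Proof. by rewrite /vge lexx orbT. Qed.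

Lemma vge_le B C x : C <= B -> vge v B x -> vge v C x.
Proof. by rewrite /vge => CB /orP[->//|/(le_trans CB)->]; rewrite orbT. Qed.

Lemma val_one : v 1 = 0.
Proof.
apply: (addrI (v 1)); rewrite addr0 -val_mul ?oner_neq0 //.
by rewrite mulr1.
Qed.

Lemma val_opp x : v (- x) = v x.
Proof.
have [->|nx] := eqVneq x 0; first by rewrite oppr0.
have n1 : (-1 : L) != 0 by rewrite oppr_eq0 oner_neq0.
rewrite -mulN1r val_mul //; suff -> : v (-1) = 0 by rewrite add0r.
have : v (-1) + v (-1) = 0 by rewrite -val_mul // mulrNN mulr1 val_one.
by rewrite -mulr2n => /eqP; rewrite mulrn_eq0 /= => /eqP.
Qed.

Lemma val_inv x : x != 0 -> v x^-1 = - v x.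
Proof.
move=> nx; apply: (addrI (v x)); rewrite subrr -val_mul ?invr_eq0 //.
by rewrite divff // val_one.
Qed.

Lemma val_exp x n : x != 0 -> v (x ^+ n) = v x *+ n.
Proof.
move=> nx; elim: n => [|n IH]; first by rewrite expr0 val_one.
by rewrite exprS mulrS val_mul ?expf_neq0 // IH.
Qed.

Lemma vgeN B x : vge v B (- x) = vge v B x.
Proof. by rewrite /vge oppr_eq0 val_opp. Qed.

Lemma vgeB B x y : vge v B x -> vge v B y -> vge v B (x - y).
Proof. by move=> hx hy; apply: vgeD; rewrite ?vgeN. Qed.

Lemma vgeM B C x y : vge v B x -> vge v C y -> vge v (B + C) (x * y).
Proof.
have [->|nx] := eqVneq x 0; first by move=> _ _; rewrite mul0r vge_0.
have [->|ny] := eqVneq y 0; first by move=> _ _; rewrite mulr0 vge_0.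
by rewrite !vge_nz ?mulf_neq0 // val_mul //; apply: lerD.
Qed.

Lemma vgeMr B x y : vge v B x -> vge v 0 y -> vge v B (x * y).
Proof. by move=> hx hy; rewrite -[B]addr0 vgeM. Qed.

Lemma vgeMl B x y : vge v 0 x -> vge v B y -> vge v B (x * y).
Proof. by move=> hx hy; rewrite -[B]add0r vgeM. Qed.

Lemma vge_1 : vge v 0 1.
Proof. by rewrite -val_one vge_val. Qed.

Lemma vgeX B x n : vge v B x -> vge v (B *+ n) (x ^+ n).
Proof.
move=> hx; elim: n => [|n IH]; first by rewrite expr0 vge_1.
by rewrite exprS mulrS vgeM.
Qed.

Lemma vgeX0 x n : vge v 0 x -> vge v 0 (x ^+ n).
Proof. by move/(vgeX n); rewrite mul0rn. Qed.

Lemma vge_nat n : vge v 0 n%:R.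
Proof. by elim: n => [|n IH]; rewrite ?vge_0 // mulrS vgeD ?vge_1. Qed.

Lemma vge_sum (I : Type) (s : seq I) (P : pred I) (E : I -> L) B :
  (forall i, P i -> vge v B (E i)) -> vge v B (\sum_(i <- s | P i) E i).
Proof.
by move=> h; apply: (big_ind (fun x => is_true (vge v B x))) => //;
  [exact: vge_0 | exact: vgeD].
Qed.

Lemma vge_prod0 (I : Type) (s : seq I) (P : pred I) (E : I -> L) :
  (forall i, P i -> vge v 0 (E i)) -> vge v 0 (\prod_(i <- s | P i) E i).
Proof.
by move=> h; apply: (big_ind (fun x => is_true (vge v 0 x))) => //;
  [exact: vge_1 | exact: vgeMr].
Qed.

Lemma vge_closed_lim u l B :
  vcvg v u l -> (forall i, vge v B (u i)) -> vge v B l.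
Proof.
move=> /(_ B)[m /(_ m (leqnn m)) hm] hu.
by rewrite -[l](subKr (u m)); apply: vgeB.
Qed.

Lemma vcvgD u1 u2 l1 l2 : vcvg v u1 l1 -> vcvg v u2 l2 ->
  vcvg v (fun i => u1 i + u2 i) (l1 + l2).
Proof.
move=> h1 h2 B; have [m1 {}h1] := h1 B; have [m2 {}h2] := h2 B.
exists (maxn m1 m2) => i; rewrite geq_max => /andP[/h1 ? /h2 ?].
by rewrite opprD addrACA vgeD.
Qed.

Lemma vcvgMl a u l : vcvg v u l -> vcvg v (fun i => a * u i) (a * l).
Proof.
have [->|na] := eqVneq a 0.
  by move=> _ B; exists 0 => i _; rewrite !mul0r subrr vge_0.
move=> h B; have [m {}h] := h (B - v a); exists m => i /h hi.
by rewrite -mulrBr -[B](subrK (v a)) addrC vgeM ?vge_val.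
Qed.

Lemma vcvg_comp u l (f : nat -> nat) : (forall i, i <= f i)%N ->
  vcvg v u l -> vcvg v (fun i => u (f i)) l.
Proof.
move=> hf h B; have [m {}h] := h B; exists m => i mi; apply: h.
exact: leq_trans (hf i).
Qed.

Lemma vcvg_sum (I : Type) (s : seq I) (P : pred I) (u : I -> nat -> L)
    (l : I -> L) : (forall i, vcvg v (u i) (l i)) ->
  vcvg v (fun k => \sum_(i <- s | P i) u i k) (\sum_(i <- s | P i) l i).
Proof.
move=> h; elim: s => [|a s IH].
  by move=> B; exists 0%N => i _; rewrite !big_nil subrr vge_0.
have [Pa|nPa] := boolP (P a); last first.
  by move=> B; have [m hm] := IH B; exists m => i /hm;
     rewrite !big_cons (negPf nPa).
move=> B; have [m hm] := vcvgD (h a) IH B; exists m => i /hm.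
by rewrite !big_cons Pa.
Qed.

(** By the ultrametric inequality a block of terms satisfies any bound that each of its terms
    satisfies, so terms tending to 0 suffice. *)
Lemma vcauchy_series (u : nat -> L) :
  (forall B, exists m, forall i, (m <= i)%N -> vge v B (u i)) ->
  vcauchy v (fun k => \sum_(1 <= i < k) u i).
Proof.
(* The shift by one makes the indices positive, so that a sum starting at 1 can be split at [i]. *)
move=> h B; have [m {}h] := h B; exists m.+1.
have aux i j : (m < i)%N -> (i <= j)%N ->
    vge v B (\sum_(1 <= k < j) u k - \sum_(1 <= k < i) u k).
  move=> mi ij; rewrite (@big_cat_nat _ _ _ i) ?(leq_trans _ mi) //= addrAC subrr add0r.
  rewrite big_nat_cond; apply: vge_sum => k; rewrite andbT => /andP[ik _].
  by apply: h; apply: leq_trans ik; apply: ltnW.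
move=> i j mi mj; have [ij|/ltnW ji] := leqP i j; last exact: aux.
by rewrite -vgeN opprB; apply: aux.
Qed.

End ValuationTheory.

(** * Completeness of finite extensions *)

Lemma rat_le_nat (B : rat) : exists k : nat, B <= k%:R.
Proof.
exists (Num.bound `|B|); apply: le_trans (ler_norm B) _.
exact/ltW/archi_boundP/normr_ge0.
Qed.

Lemma vge_eq0 (L : fieldType) (v : L -> rat) (x : L) :
  (forall B, vge v B x) -> x = 0.
Proof.
move=> h; apply/eqP; have /orP[//|] := h (v x + 1).
by rewrite gerDl; move/(lt_le_trans ltr01); rewrite ltxx.
Qed.

Section Completeness.
Variables (Qp : fieldType) (vp : Qp -> rat) (N : fieldExtType Qp) (v : N -> rat).
Hypothesis hv : is_valuation v.
Hypothesis hv_ext : forall a : Qp, a != 0 -> v (a%:A) = vp a.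
Hypothesis Qp_complete : forall u, vcauchy vp u -> exists l, vcvg vp u l.

Lemma valZ a x : a != 0 -> x != 0 -> v (a *: x) = vp a + v x.
Proof.
move=> na nx; rewrite -mulr_algl val_mul // ?hv_ext //.
by rewrite scaler_eq0 negb_or na oner_neq0.
Qed.

Lemma vgeZ B C a x : vge vp B a -> vge v C x -> vge v (B + C) (a *: x).
Proof.
have [->|na] := eqVneq a 0; first by move=> _ _; rewrite scale0r vge_0.
have [->|nx] := eqVneq x 0; first by move=> _ _; rewrite scaler0 vge_0.
rewrite !vge_nz ?scaler_eq0 ?negb_or ?na // valZ //; exact: lerD.
Qed.

Definition vcomplete (U : {vspace N}) : Prop :=
  forall u, (forall i, u i \in U) -> vcauchy v u ->
  exists2 l, l \in U & vcvg v u l.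

(* Otherwise some sequence in U converges to - e. *)
Lemma vcomplete_dist U e : vcomplete U -> e \notin U ->
  exists B, forall w, w \in U -> ~~ vge v B (w + e).
Proof.
move=> cU eU; apply: boolp.contrapT => nB.
have hw k : exists w, (w \in U) && vge v (k%:R : rat) (w + e).
  apply: boolp.contrapT => nw; apply: nB; exists k%:R => w wU.
  by apply/negP => hw; apply: nw; exists w; rewrite wU.
pose w k := xchoose (hw k).
have wU k : w k \in U by have /andP[] := xchooseP (hw k).
have we B : exists m, forall k, (m <= k)%N -> vge v B (w k + e).
  have [m Bm] := rat_le_nat B; exists m => k mk.
  have /andP[_] := xchooseP (hw k); apply: vge_le; apply: le_trans Bm _.
  by rewrite ler_nat.
have [B|l lU hl] := cU w wU.
  have [m hm] := we B; exists m => i j /hm hi /hm hj.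
  have -> : w i - w j = (w i + e) - (w j + e) by ring.
  exact: vgeB.
suff /eqP : l + e = 0 by rewrite addrC addr_eq0 => /eqP ee;
  move: eU; rewrite ee memvN lU.
apply: (@vge_eq0 _ v) => B; have [m1 h1] := we B; have [m2 h2] := hl B.
have /h1 k1 := leq_maxl m1 m2; have /h2 k2 := leq_maxr m1 m2.
have -> : l + e = (w (maxn m1 m2) + e) - (w (maxn m1 m2) - l) by ring.
exact: vgeB.
Qed.

(** Since [e] stays away from [U], the coordinate along [e] is controlled by the whole vector; hence
    both components of a Cauchy sequence are Cauchy. *)
Lemma vcomplete_add_line U e : vcomplete U -> vcomplete (U + <[e]>)%VS.
Proof.
move=> cU; have [eU|neU] := boolP (e \in U).
  by have /addv_idPl-> : (<[e]> <= U)%VS by rewrite -memvE.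
have [B hB] := vcomplete_dist cU neU.
have ne : e != 0 by apply: contraNneq neU => ->; rewrite mem0v.
(* For nonzero [a], the vector [a^-1 *: w + e] has valuation below [B], so v(w + a e) < vp(a) +
   B. *)
have bound C w a : w \in U -> vge v C (w + a *: e) -> vge vp (C - B) a.
  move=> wU; have [->|na] := eqVneq a 0; first by rewrite vge_0.
  have := hB (a^-1 *: w) (memvZ _ wU).
  have -> : a^-1 *: w + e = a^-1 *: (w + a *: e).
    by rewrite scalerDr scalerA mulVf // scale1r.
  set x := w + _; have [->|nx] := eqVneq x 0; first by rewrite scaler0 vge_0.
  have na' : a^-1%:A != 0 :> N.
    by rewrite scaler_eq0 negb_or invr_eq0 na oner_neq0.
  rewrite !vge_nz // ?scaler_eq0 ?negb_or ?invr_eq0 ?na // -ltNge => xB Cx.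
  have va : vp a^-1 = - vp a.
    rewrite -!hv_ext ?invr_eq0 // -val_inv ?scaler_eq0 ?negb_or ?na ?oner_neq0 //.
    by congr v; rewrite -in_algE fmorphV.
  rewrite valZ ?invr_eq0 // va in xB.
  by rewrite lerBlDr; apply/ltW/(le_lt_trans Cx); rewrite -ltrBlDl addrC.
move=> u uU hu.
have ha i : exists a, u i - a *: e \in U.
  have /memv_addP[w wU [_ /vlineP[a ->] ->]] := uU i.
  by exists a; rewrite addrK.
pose a i := xchoose (ha i); pose w i := u i - a i *: e.
have wU i : w i \in U := xchooseP (ha i).
have uE i : u i = w i + a i *: e by rewrite subrK.
have [C|al hal] := Qp_complete (u := a).
  have [m hm] := hu (C + B); exists m => i j mi mj.
  rewrite -[C](addrK B); apply: (bound _ (w i - w j)); first by rewrite memvB.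
  by rewrite scalerBl addrACA -opprD -!uE hm.
have hae : vcvg v (fun i => a i *: e) (al *: e).
  move=> C; have [m hm] := hal (C - v e); exists m => i /hm hi.
  by rewrite -scalerBl -[C](subrK (v e)) vgeZ ?vge_val.
have [C|l lU hl] := cU w wU.
  have [m1 h1] := hu C; have [m2 h2] := hae C; exists (maxn m1 m2) => i j.
  rewrite !geq_max => /andP[i1 i2] /andP[j1 j2].
  have -> : w i - w j = (u i - u j) - ((a i *: e - al *: e) - (a j *: e - al *: e)).
    by rewrite !uE; ring.
  by apply: vgeB => //; [exact: h1 | apply: vgeB => //; exact: h2].
exists (l + al *: e); first by rewrite memv_add ?memvZ ?memv_line.
move=> C; have [m hm] := vcvgD hv hl hae C; exists m => i /hm.
by rewrite -uE.
Qed.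

Lemma vcomplete_vspace U : vcomplete U.
Proof.
have <- := span_basis (vbasisP U); elim: (tval (vbasis U)) => [|e X IH].
  rewrite span_nil => u u0 _; exists 0; first exact: mem0v.
  move=> B; exists 0%N => i _; have := u0 i; rewrite memv0 => /eqP->.
  by rewrite subrr vge_0.
by rewrite span_cons addvC; apply: vcomplete_add_line.
Qed.

End Completeness.

(** * The Jacobson radical of the integral group ring *)

Section JacobsonTheory.
Variables (R : nzRingType) (A : {pred R}).
Hypothesis Aring : GRing.subring_closed A.

(** Zorn's lemma, applied to the proper left ideals that contain [I0]. *)
Lemma maximal_left_ideal_exists I0 : left_ideal A I0 -> ~ I0 1 ->
  exists2 I, maximal_left_ideal A I & forall x, I0 x -> I x.
Proof.
move=> lI0 nI0.
pose P (X : R -> Prop) := (forall x, ~ X x) \/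
  [/\ left_ideal A X, ~ X 1 & forall x, I0 x -> X x].
have [F FP Ftot|I [PI Imax]] := @classical_sets.Zorn_bigcup R P.
  have [[X [FX X0]]|noX] := boolp.EM (exists X, F X /\ X 0); last first.
    left=> x [X FX Xx]; have [eX|[[_ X0 _ _] _ _]] := FP X FX.
      exact: eX Xx.
    by apply: noX; exists X.
  have good Y y : F Y -> Y y -> [/\ left_ideal A Y, ~ Y 1 & forall x, I0 x -> Y x].
    by move=> FY Yy; have [/(_ y)/(_ Yy)|] := FP Y FY.
  right; split.
  - split.
    + by move=> x [Y FY Yx]; have [[YA _ _ _] _ _] := good _ _ FY Yx; apply: YA.
    + by exists X.
    + move=> x y [Y FY Yx] [Z FZ Zy].
      have [[_ _ YB _] _ _] := good _ _ FY Yx.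
      have [[_ _ ZB _] _ _] := good _ _ FZ Zy.
      have [YZ|ZY] := Ftot _ _ FY FZ.
        by exists Z => //; apply: ZB => //; apply: YZ.
      by exists Y => //; apply: YB => //; apply: ZY.
    + move=> a x aA [Y FY Yx]; exists Y => //.
      by have [[_ _ _ YM] _ _] := good _ _ FY Yx; apply: YM.
  - by move=> [Y FY Y1]; have [_ nY1 _] := good _ _ FY Y1.
  - move=> x Ix; exists X => //; have [_ _ hX] := good _ _ FX X0; exact: hX.
have [I0' [_ I00 _ _]] := (I0, lI0).
case: PI => [eI|[lI nI I0I]].
  case: (Imax I0); last by right; split.
  by split=> [x /eI//|/(_ 0 I00)/eI].
exists I => //; split=> // J lJ nJ IJ x Jx; apply: boolp.contrapT => nIx.
apply: (Imax J); last by right; split=> // y /I0I /IJ.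
by split=> // /(_ x Jx).
Qed.

(** Otherwise the left ideal generated by 1 - a r lies in a maximal one, which also contains a r,
    hence 1. *)
Lemma jacobson_left_inv r a : jacobson A r -> a \in A ->
  exists2 u, u \in A & u * (1 - a * r) = 1.
Proof.
move=> [rA hr] aA; have [A1 AB AM] := Aring.
pose I0 x := exists2 b, b \in A & x = b * (1 - a * r).
have lI0 : left_ideal A I0.
  split.
  - by move=> _ [b bA ->]; apply: (AM) => //; apply: AB => //; apply: AM.
  - by exists 0; rewrite ?mul0r // -[0](subrr 1); apply: AB.
  - move=> _ _ [b bA ->] [c cA ->].
    by exists (b - c); rewrite ?mulrBl //; apply: AB.
  - by move=> c _ cA [b bA ->]; exists (c * b); rewrite ?mulrA //; apply: AM.
have [[u uA u1]|nI0] := boolp.EM (I0 1); first by exists u.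
have [I mI I0I] := maximal_left_ideal_exists lI0 nI0.
have [[_ I_0 IB IM] nI1 _] := mI.
have e : 1 = (1 - a * r) - (0 - a * r) by rewrite sub0r opprK subrK.
case: nI1; rewrite {}e.
apply: (IB); first by apply: I0I; exists 1; rewrite ?mul1r.
by apply: IB => //; apply: IM => //; apply: hr.
Qed.

End JacobsonTheory.

(** * Coefficients in the group algebra *)

Section GroupAlgebraTheory.
Variables (R : nzRingType) (G : finGroupType).
Implicit Types (f g : grpalg R G) (x : G).

Lemma grp_coef0 x : coef (0 : grpalg R G) x = 0.
Proof. by rewrite /coef ffunE. Qed.

Lemma grp_coefN f x : coef (- f) x = - coef f x.
Proof. by rewrite /coef [LHS]ffunE. Qed.

Lemma grp_coefB f g x : coef (f - g) x = coef f x - coef g x.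
Proof. by rewrite Defs.coefD grp_coefN. Qed.

Lemma grp_coef_sum (I : Type) (s : seq I) (P : pred I) (F : I -> grpalg R G) x :
  coef (\sum_(i <- s | P i) F i) x = \sum_(i <- s | P i) coef (F i) x.
Proof.
by apply: (big_morph (fun f => coef f x)) => [f g|]; rewrite ?Defs.coefD ?grp_coef0.
Qed.

Lemma grp_coefZ a f x : coef (a *: f) x = a * coef f x.
Proof. exact: coef_scale. Qed.

Lemma grp_coefM f g x : coef (f * g) x = \sum_y coef f y * coef g (y^-1 * x)%g.
Proof. exact: coef_mul. Qed.

Lemma grp_scaleMl a f g : (a *: f) * g = a *: (f * g).
Proof.
apply: grpP => x; rewrite grp_coefZ !grp_coefM big_distrr /=.
by apply: eq_bigr => y _; rewrite grp_coefZ mulrA.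
Qed.

Lemma grp_coef1 x : coef (1 : grpalg R G) x = (x == 1%g)%:R.
Proof. exact: coef_elt. Qed.

End GroupAlgebraTheory.

Lemma grp_scaleMr (R : comNzRingType) (G : finGroupType) a (f g : grpalg R G) :
  f * (a *: g) = a *: (f * g).
Proof.
apply: grpP => x; rewrite grp_coefZ !grp_coefM big_distrr /=.
by apply: eq_bigr => y _; rewrite grp_coefZ mulrCA.
Qed.

Lemma subring_sum (R : nzRingType) (A : {pred R}) (I : Type) (s : seq I)
    (P : pred I) (F : I -> R) :
  GRing.subring_closed A -> (forall i, P i -> F i \in A) ->
  \sum_(i <- s | P i) F i \in A.
Proof.
move=> [A1 AB AM] FA.
have A0 : 0 \in A by rewrite -[0](subrr 1); apply: AB.
apply: (big_ind (fun x => x \in A)) => // x y xA yA.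
rewrite -[y]opprK; apply: (AB) => //.
by rewrite -[- y]sub0r; apply: AB.
Qed.

Lemma subring_exp (R : nzRingType) (A : {pred R}) x n :
  GRing.subring_closed A -> x \in A -> x ^+ n \in A.
Proof.
move=> [A1 AB AM] xA; elim: n => [|n IH]; first by rewrite expr0.
by rewrite exprS; apply: AM.
Qed.

Lemma grpalg_over_subring (R : nzRingType) (G : finGroupType) (A : {pred R}) :
  GRing.subring_closed A -> GRing.subring_closed (@grpalg_over R G A).
Proof.
move=> Aring; have [A1 AB AM] := Aring; split.
- apply/forallP => x; rewrite grp_coef1; case: eqP => // _.
  by rewrite -[_%:R](subrr 1); apply: AB.
- move=> f g /forallP fA /forallP gA.
  by apply/forallP => x; rewrite grp_coefB; apply: AB.
- move=> f g /forallP fA /forallP gA; apply/forallP => x; rewrite grp_coefM.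
  by apply: subring_sum => // y _; apply: AM.
Qed.

Section GroupAlgebraValuation.
Variables (L : fieldType) (v : L -> rat) (G : finGroupType).
Hypothesis hv : is_valuation v.
Implicit Types (f g : grpalg L G) (B C : rat).

Definition gvge B f : Prop := forall x, vge v B (coef f x).

Lemma gvge1 : gvge 0 1.
Proof. by move=> x; rewrite grp_coef1 vge_nat. Qed.

Lemma gvgeM B C f g : gvge B f -> gvge C g -> gvge (B + C) (f * g).
Proof. by move=> hf hg x; rewrite grp_coefM; apply: vge_sum => // y _; apply: vgeM. Qed.

Lemma gvgeX B f n : gvge B f -> gvge (B *+ n) (f ^+ n).
Proof.
move=> hf; elim: n => [|n IH]; first by rewrite expr0 mulr0n; exact: gvge1.
by rewrite exprS mulrS; apply: gvgeM.
Qed.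

End GroupAlgebraValuation.

(** * Powers of radical elements become divisible by the uniformizer *)

Section Nilpotence.
Variables (Qp : fieldType) (N : fieldExtType Qp) (G : finGroupType).
Variables (v : N -> rat) (M : {subfield N}) (pi : N).
Hypothesis hv : is_valuation v.
Hypothesis hpi : uniformizer v (mem M) pi.
Local Notation O := (valring v (mem M)).

Lemma valringP x : reflect (x \in M /\ vge v 0 x) (x \in O).
Proof. exact: andP. Qed.

Lemma valring_subring : GRing.subring_closed O.
Proof.
split.
- by apply/valringP; rewrite rpred1 vge_1.
- move=> x y /valringP[xM xO] /valringP[yM yO].
  by apply/valringP; rewrite rpredB //; split=> //; apply: vgeB.
- move=> x y /valringP[xM xO] /valringP[yM yO].
  by apply/valringP; rewrite rpredM //; split=> //; apply: vgeMr.
Qed.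

Lemma val_uniformizer_gt0 : 0 < v pi.
Proof.
have [piM npi hpi'] := hpi.
have : pi \in valmax v (mem M).
  by apply/hpi'; exists 1; rewrite ?mulr1 //; case: valring_subring.
by case/andP => _; rewrite /vgt (negPf npi).
Qed.

Lemma valmax_vge x : x \in M -> vgt v 0 x -> vge v (v pi) x.
Proof.
have [piM npi hpi'] := hpi; move=> xM xv.
have /hpi'[y /valringP[_ yO] ->] : x \in valmax v (mem M) by apply/andP.
by apply: vgeMr => //; apply: vge_val.
Qed.

(** Enough powers of [r] are dependent because N[G] has finite dimension over [Qp]. Coefficients
    taken in [Qp] automatically lie in [M]. *)
Lemma grpalg_algebraic (r : grpalg N G) :
  exists (d : nat) (c : nat -> Qp),
    (exists2 i, (i < d)%N & c i != 0) /\
    \sum_(i < d) (c i)%:A *: r ^+ i = 0 :> grpalg N G.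
Proof.
pose d := (\dim {: {ffun G -> N}}).+1.
pose X : d.-tuple {ffun G -> N} := [tuple (r ^+ i : grpalg N G) | i < d].
have : ~~ free X.
  apply/negP => fX; have := dim_span X.
  have := dimvS (subvf <<X>>%VS); rewrite (eqnP fX) size_tuple.
  by rewrite ltnn.
move=> nfX; have nX := elimN freeP nfX; exists d.
have [k nk] : exists k : 'I_d -> Qp,
    ~ (\sum_(i < d) k i *: X`_i = 0 -> forall i, k i = 0).
  apply: boolp.contrapT => nk; apply: nX => k; apply: boolp.contrapT => nk'.
  by apply: nk; exists k.
have [k0 nk0] : \sum_(i < d) k i *: X`_i = 0 /\ exists i, k i != 0.
  split; apply: boolp.contrapT => h; apply: nk => // k0 i.
  by apply/eqP; apply: boolp.contrapT => ki; apply: h; exists i; apply/negP.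
exists (fun i => if insub i is Some j then k j else 0); split.
  by have [i ki] := nk0; exists i => //; rewrite valK.
apply: grpP => x; rewrite grp_coef_sum grp_coef0.
have := congr1 (fun f : {ffun G -> N} => f x) k0.
rewrite sum_ffunE ffunE; apply: etrans; apply: eq_bigr => i _.
by rewrite grp_coefZ valK ffunE -tnth_nth tnth_mktuple mulr_algl.
Qed.

Lemma jacobson_nilpotent (r : grpalg N G) :
  jacobson (grpalg_over O) r ->
  exists2 m, (0 < m)%N & gvge v (v pi) (r ^+ m).
Proof.
move=> hr; have [d [c [[i0 i0d ci0] c0]]] := grpalg_algebraic r.
pose w i := v (c i)%:A.
(* [P] selects the coefficients of least valuation; the first of them is used below. *)
pose P m := [&& (m < d)%N, c m != 0 & [forall j : 'I_d, (c j != 0) ==> (w m <= w j)]].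
have exP : exists m, P m.
  case: (@arg_minP _ _ 'I_d (Ordinal i0d) (fun i => c i != 0) w ci0) => i ci hi.
  by exists i; apply/and3P; split=> //; apply/forallP => j; apply/implyP/hi.
case: (ex_minnP exP) => m /and3P[md cm /forallP wm] mmin {exP}.
have [rA _] := hr.
have Oring := valring_subring; have Aring := @grpalg_over_subring _ G _ Oring.
(* Division by the selected coefficient makes the relation integral with [e m = 1]; the earlier
   coefficients, of strictly larger valuation, fall in the maximal ideal. *)
pose e i : N := (c i / c m)%:A.
have eE i : e i = (c i)%:A / (c m)%:A.
  by rewrite /e -!in_algE rmorphM fmorphV.
have ncm : (c m)%:A != 0 :> N by rewrite scaler_eq0 negb_or cm oner_neq0.
have eM i : e i \in M by rewrite memvZ ?mem1v.
have em : e m = 1 by rewrite eE divff.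
have ve i : c i != 0 -> v (e i) = w i - w m.
  move=> ci; rewrite eE val_mul ?val_inv ?invr_eq0 //.
  by rewrite scaler_eq0 negb_or ci oner_neq0.
have e0 i : c i = 0 -> e i = 0 by rewrite eE => ->; rewrite scale0r mul0r.
have eO i : (i < d)%N -> vge v 0 (e i).
  move=> id; have [/e0->|ci] := eqVneq (c i) 0; first exact: vge_0.
  have /implyP/(_ ci) /= := wm (Ordinal id).
  by rewrite /vge ve // subr_ge0 => ->; rewrite orbT.
have eOA i : (i < d)%N -> e i \in O by move=> id; apply/valringP; rewrite eM eO.
have elo i : (i < m)%N -> vge v (v pi) (e i).
  move=> im; have id := ltn_trans im md; apply: valmax_vge => //.
  have [/e0->|ci] := eqVneq (c i) 0; first by rewrite /vgt eqxx.
  rewrite /vgt ve // subr_gt0 orbC ltNge; case: leP => //= wim.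
  suff /mmin : P i by rewrite leqNgt im.
  rewrite /P id ci /=; apply/forallP => j; apply/implyP => cj.
  by apply: le_trans wim _; have /implyP := wm j; apply.
have e_sum : \sum_(0 <= i < d) e i *: r ^+ i = 0.
  rewrite big_mkord; transitivity ((c m)%:A^-1 *: (0 : grpalg N G)).
    2: by rewrite scaler0.
  apply: etrans (congr1 _ c0); rewrite scaler_sumr; apply: eq_bigr => i _.
  by rewrite scalerA eE mulrC.
rewrite (@big_cat_nat _ _ _ m) ?(ltnW md) //= (big_ltn md) em scale1r in e_sum.
set lo := \sum_(0 <= i < m) _ in e_sum.
(* The terms of degree above [m] add up to - r^m b r. *)
pose b := - \sum_(m.+1 <= i < d) e i *: r ^+ (i - m.+1).
have bA : b \in grpalg_over O.
  have [A1 AB AM] := Aring; rewrite -[b]sub0r; apply: (AB).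
    by rewrite -[0](subrr 1); apply: AB.
  rewrite big_nat; apply: subring_sum => // i /andP[_ id].
  apply/forallP => x; rewrite grp_coefZ; have [_ _ OM] := Oring.
  apply: OM; first exact: eOA.
  by have /forallP := subring_exp (i - m.+1) Aring rA; apply.
have rbr : r ^+ m * (1 - b * r) = - lo.
  apply/eqP; rewrite -addr_eq0 -[X in _ == X]e_sum addrC; apply/eqP; congr (_ + _).
  rewrite mulrBr mulr1; congr (_ + _); rewrite mulNr mulrN opprK.
  rewrite mulr_suml mulr_sumr; apply: eq_big_nat => i /andP[mi _].
  by rewrite grp_scaleMl grp_scaleMr -exprSr -exprD -addSnnS subnKC.
(* [b] is a polynomial in [r], so the two factors commute and a left inverse of 1 - b r can be
   applied. *)
have brC : (1 - b * r) * r ^+ m = r ^+ m * (1 - b * r).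
  rewrite mulrBl mulrBr mul1r mulr1 -mulrA -exprS exprSr; congr (_ - _).
  rewrite !mulrA; congr (_ * r); rewrite mulNr mulrN mulr_suml mulr_sumr; congr (- _).
  by apply: eq_bigr => i _; rewrite grp_scaleMl grp_scaleMr -!exprD addnC.
have rO : gvge v 0 r by move=> x; have /forallP/(_ x)/valringP[] := rA.
have [u uA ub] := jacobson_left_inv Aring hr bA.
have rm : r ^+ m = u * - lo by rewrite -rbr -brC mulrA ub mul1r.
(* The index [m] may be 0; one more factor [r] makes the exponent positive. *)
exists m.+1 => //; rewrite exprSr -[v pi]addr0; apply: gvgeM => //.
rewrite rm -[v pi]add0r; apply: gvgeM => //.
  by move=> x; have /forallP/(_ x)/valringP[] := uA.
move=> x; rewrite grp_coefN vgeN // grp_coef_sum big_nat; apply: vge_sum => // i im.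
rewrite grp_coefZ; apply: vgeMr => //; first exact: elo.
by have := gvgeX hv i rO; rewrite mul0rn; apply.
Qed.

End Nilpotence.

(** * Words up to rotation *)

(** The remainder of [k] modulo the order also fixes [x], and among the numbers below the order only
    0 does. *)
Lemma fun_order_dvdn (T : finType) (f : T -> T) (x : T) k :
  injective f -> iter k f x = x -> (fingraph.order f x %| k)%N.
Proof.
move=> injf; have per j : iter (j * fingraph.order f x) f x = x.
  by elim: j => [|j IH] //; rewrite mulSn iterD IH iter_order.
rewrite {1}(divn_eq k (fingraph.order f x)) addnC iterD per => fx.
have lt := ltn_pmod k (fingraph.order_gt0 f x).
by rewrite /dvdn -(findex_iter lt) fx findex0.
Qed.

(** [t] is constant on each orbit of [f], so an orbit contributes its common value times its size.
    Orbits are indexed by their roots. *)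
Lemma orbit_sum_closed (T : finType) (f : T -> T) (V : nmodType) (S : {pred V})
    (P : pred T) (t : T -> V) :
  injective f -> (forall x, t (f x) = t x) -> (forall x, P (f x) = P x) ->
  0 \in S -> {in S &, forall a b, a + b \in S} ->
  (forall x, P x -> t x *+ fingraph.order f x \in S) -> \sum_(x | P x) t x \in S.
Proof.
move=> injf tf Pf S0 SD tS.
have conn (U : eqType) (g : T -> U) x y :
    (forall x, g (f x) = g x) -> fconnect f x y -> g y = g x.
  by move=> gf /iter_findex <-; elim: (findex f x y) => //= i IH; rewrite gf.
have csym := fconnect_sym injf.
rewrite (partition_big (froot f) predT) //=.
apply: (big_ind (fun a => a \in S)) => // y _.
have [Py|nPy] := boolP (P y && (froot f y == y)); last first.
  rewrite big1 // => x /andP[Px /eqP xy]; case/negP: nPy.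
  rewrite -xy root_root // eqxx andbT.
  by rewrite (conn _ P x _ Pf) // connect_root.
have /andP[{}Py /eqP ry] := Py.
rewrite (eq_bigr (fun=> t y)) => [|x /andP[_ /eqP xy]]; last first.
  by rewrite -xy [RHS](conn _ t x) // connect_root.
rewrite sumr_const; suff -> : #|[pred x | P x & froot f x == y]| = fingraph.order f y.
  exact: tS.
apply: eq_card => x; rewrite !inE -{1}ry root_connect // csym.
by have [/(conn _ P _ _ Pf)->|] := boolP (fconnect f y x); rewrite ?Py ?andbF.
Qed.

(* [all_solvable] shadows [rot] by a set of permutations. *)
Local Notation rot := seq.rot.

Section Words.
Variables (T : eqType).
Implicit Types (w u : seq T).

Lemma iter_rot1 i w : (i <= size w)%N -> iter i (rot 1%N) w = rot i w.
Proof.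
elim: i => [|i IH] lt; first by rewrite rot0.
by rewrite iterS IH ?(ltnW lt) // -rotS.
Qed.

Lemma flatten_nseqC k u : flatten (nseq k u) ++ u = u ++ flatten (nseq k u).
Proof. by elim: k => [|k IH] /=; rewrite ?cats0 // -catA IH. Qed.

Lemma size_flatten_nseq k u : size (flatten (nseq k u)) = (k * size u)%N.
Proof. by elim: k => [|k IH] //=; rewrite size_cat IH mulSn. Qed.

Lemma rot_flatten_nseq k u : rot (size u) (flatten (nseq k u)) = flatten (nseq k u).
Proof.
by case: k => [|k] //=; rewrite rot_size_cat flatten_nseqC.
Qed.

(** Rotation invariance says that the first block x commutes with the rest y. So a nonempty y again
    begins with x and is invariant, and induction applies to it. *)
Lemma rot_periodic d k w : rot d w = w -> size w = (k * d)%N ->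
  w = flatten (nseq k (take d w)).
Proof.
elim: k w => [|k IH] w rw sw; first by apply/size0nil; rewrite sw mul0n.
pose x := take d w; pose y := drop d w.
have wxy : w = x ++ y by rewrite cat_take_drop.
have wyx : w = y ++ x by rewrite -[LHS]rw.
have sx : size x = d by rewrite size_takel // sw mulSn leq_addr.
have sy : size y = (k * d)%N by rewrite size_drop sw mulSn addKn.
rewrite -/x /= [LHS]wxy; congr (_ ++ _).
case: k => [|k] in IH sw sy *; first by apply/size0nil; rewrite sy.
have dy : (d <= size y)%N by rewrite sy mulSn leq_addr.
have xy : take d y = x.
  by rewrite -(take_size_cat y sx) -wxy wyx takel_cat.
rewrite -[in RHS]xy; apply: IH => //.
have : x ++ rot d y = x ++ y.
  by rewrite -wxy wyx /rot xy catA -[in RHS](cat_take_drop d y) xy.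
by move/eqP; rewrite eqseq_cat // eqxx => /eqP.
Qed.

End Words.

(** * Expansion of powers over words *)

Section WordExpansion.
Variables (R : comNzRingType) (G : finGroupType) (r : grpalg R G).
Implicit Types (w u : seq G).

Definition wcoef w : R := \prod_(a <- w) coef r a.
Definition wprod w : G := (\prod_(a <- w) a)%g.

Lemma grp_elt_sum (f : grpalg R G) : f = \sum_x coef f x *: grp_elt R x.
Proof.
apply: grpP => y; rewrite grp_coef_sum (bigD1 y) //= big1 => [|x xy].
  by rewrite grp_coefZ coef_elt eqxx mulr1 addr0.
by rewrite grp_coefZ coef_elt eq_sym (negPf xy) mulr0.
Qed.

Lemma grp_eltM (x y : G) : grp_elt R x * grp_elt R y = grp_elt R (x * y)%g.
Proof.
apply: grpP => z; rewrite grp_coefM (bigD1 x) //= big1 => [|t tx].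
  rewrite !coef_elt eqxx mul1r addr0; congr (nat_of_bool _)%:R.
  by rewrite -[z in RHS](mulKVg x) (inj_eq (mulgI x)).
by rewrite coef_elt (negPf tx) mul0r.
Qed.

Lemma grp_exp_words m : r ^+ m =
  \sum_(w : m.-tuple G) wcoef w *: grp_elt R (wprod w).
Proof.
elim: m => [|m IH].
  rewrite (bigD1 [tuple]) //= big1 => [|w]; last by rewrite [w]tuple0 => /eqP[].
  by rewrite /wcoef /wprod !big_nil scale1r addr0.
rewrite exprS IH [X in X * _]grp_elt_sum big_distrl /=.
under eq_bigr do rewrite big_distrr /=.
rewrite pair_big /=.
rewrite [RHS](reindex (fun aw : G * m.-tuple G => [tuple of aw.1 :: aw.2])) /=.
  apply: eq_bigr => -[a w] _ /=.
  rewrite /wcoef /wprod !big_cons -/(wcoef w) -/(wprod w).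
  by rewrite grp_scaleMl grp_scaleMr scalerA grp_eltM.
exists (fun t => (thead t, [tuple of behead t])) => [[a t]|t] _ /=.
  by congr pair; apply: val_inj.
by rewrite -tuple_eta.
Qed.

Lemma wcoef_rot i w : wcoef (rot i w) = wcoef w.
Proof. by rewrite /wcoef -(perm_big _ (permEl (perm_rot i w))). Qed.

Lemma wcoef_flatten_nseq k u : wcoef (flatten (nseq k u)) = wcoef u ^+ k.
Proof.
elim: k => [|k IH]; first by rewrite /wcoef big_nil.
by rewrite /= /wcoef big_cat /= exprS -IH.
Qed.

Lemma wprod_flatten_nseq k u : wprod (flatten (nseq k u)) = (wprod u ^+ k)%g.
Proof.
elim: k => [|k IH]; first by rewrite /wprod big_nil.
by rewrite /= /wprod big_cat /= expgS -IH.
Qed.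

(** Moving the first letter to the end conjugates the product by that letter; this is why class
    functions are blind to rotation. *)
Lemma wprod_rot1 w : exists y, wprod (rot 1%N w) = (wprod w ^ y)%g.
Proof.
case: w => [|a w]; first by exists 1%g; rewrite conjg1.
exists a; rewrite rot1_cons -cats1 /wprod big_cat /= !big_cons big_nil mulg1.
by rewrite conjgE mulgA mulKg.
Qed.

Variable chi : G -> R.
Hypothesis chiJ : forall x y, chi (x ^ y)%g = chi x.

Lemma chi_rot1 k w : chi (wprod (rot 1%N w) ^+ k)%g = chi (wprod w ^+ k)%g.
Proof. by have [y ->] := wprod_rot1 w; rewrite -conjXg chiJ. Qed.

(** The linear extension of [chi] to the group algebra; for the indicator of a class it is a
    coordinate of [conj_map]. *)
Definition gtrace (f : grpalg R G) : R := \sum_x coef f x * chi x.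

Lemma gtrace_elt a x : gtrace (a *: grp_elt R x) = a * chi x.
Proof.
rewrite /gtrace (bigD1 x) //= big1 => [|y yx].
  by rewrite grp_coefZ coef_elt eqxx mulr1 addr0.
by rewrite grp_coefZ coef_elt (negPf yx) mulr0 mul0r.
Qed.

Lemma gtrace_sum (I : Type) (s : seq I) (P : pred I) (f : I -> grpalg R G) :
  gtrace (\sum_(i <- s | P i) f i) = \sum_(i <- s | P i) gtrace (f i).
Proof.
rewrite /gtrace exchange_big /=; apply: eq_bigr => x _.
by rewrite grp_coef_sum mulr_suml.
Qed.

Lemma gtraceZ a f : gtrace (a *: f) = a * gtrace f.
Proof.
by rewrite /gtrace mulr_sumr; apply: eq_bigr => x _; rewrite grp_coefZ mulrA.
Qed.

Lemma gtraceB f g : gtrace (f - g) = gtrace f - gtrace g.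
Proof.
by rewrite /gtrace -sumrB; apply: eq_bigr => x _; rewrite grp_coefB mulrBl.
Qed.

Lemma gtrace_exp m :
  gtrace (r ^+ m) = \sum_(w : m.-tuple G) wcoef w * chi (wprod w).
Proof.
by rewrite grp_exp_words gtrace_sum; apply: eq_bigr => w _; rewrite gtrace_elt.
Qed.

Lemma gtrace_hatF_exp (F : {rmorphism R -> R}) s m :
  gtrace (hatF F s (r ^+ m)) =
    \sum_(w : m.-tuple G) F (wcoef w) * chi (wprod w ^+ s)%g.
Proof.
rewrite /hatF gtrace_sum.
under eq_bigr do rewrite gtrace_elt grp_exp_words grp_coef_sum rmorph_sum mulr_suml /=.
rewrite exchange_big /=; apply: eq_bigr => w _.
rewrite (bigD1 (wprod w)) //= big1 => [|y yw].
  by rewrite grp_coefZ coef_elt eqxx mulr1 addr0.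
by rewrite grp_coefZ coef_elt (negPf yw) mulr0 rmorph0 mul0r.
Qed.

End WordExpansion.

Section TupleRotation.
Variables (T : finType) (m : nat).

Definition rot1_tuple (w : m.-tuple T) : m.-tuple T := [tuple of rot 1%N w].

Lemma rot1_tuple_inj : injective rot1_tuple.
Proof. by move=> w1 w2 /(congr1 val) /= /rot_inj /val_inj. Qed.

Lemma iter_rot1_tuple i (w : m.-tuple T) : (i <= m)%N ->
  val (iter i rot1_tuple w) = rot i w.
Proof.
move=> im; rewrite -iter_rot1 ?size_tuple //.
by elim: i {im} => [|i IH] //=; rewrite IH.
Qed.

(** The orbit size [d] is the least period of the word. Rotation by the full length [m] is the
    identity, so [d] divides [m], and [rot_periodic] applies. *)
Lemma rot1_order (w : m.-tuple T) (d := fingraph.order rot1_tuple w) :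
  [/\ (d %| m)%N, val w = flatten (nseq (m %/ d) (take d w))
    & forall i, (i <= m)%N -> rot i w = w -> (d %| i)%N].
Proof.
have dvd i : (i <= m)%N -> rot i w = w -> (d %| i)%N.
  move=> im ri; apply: fun_order_dvdn; first exact: rot1_tuple_inj.
  by apply: val_inj; rewrite iter_rot1_tuple.
have dm : (d %| m)%N by apply: dvd; rewrite // -[X in rot X](size_tuple w) rot_size.
split=> //; apply: rot_periodic; last by rewrite divnK // size_tuple.
(* The empty word is separate: its orbit has size 1, which exceeds its length. *)
have [m0|m0] := posnP m.
  by have /size0nil -> : size (val w) = 0%N by rewrite size_tuple.
rewrite -iter_rot1_tuple; last exact: dvdn_leq.
by congr (val _); apply: iter_order rot1_tuple_inj w.
Qed.

End TupleRotation.

Lemma flatten_nseq_tupleP (T : eqType) s j (u : j.-tuple T) :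
  size (flatten (nseq s (val u))) == (s * j)%N.
Proof. by rewrite size_flatten_nseq size_tuple. Qed.
Canonical flatten_nseq_tuple (T : eqType) s j (u : j.-tuple T) :=
  Tuple (flatten_nseq_tupleP s u).

(** The bijection sends u to its [s]-th power; its inverse takes the prefix of length [j], which
    recovers u as [s] is positive. *)
Lemma sum_rot_fixed (T : finType) (V : nmodType) s j (E : seq T -> V) :
  (0 < s)%N ->
  \sum_(w : (s * j).-tuple T | rot j w == w) E w =
  \sum_(u : j.-tuple T) E (flatten (nseq s (val u))).
Proof.
move=> s0; have js : (j <= s * j)%N by rewrite leq_pmull.
have sz (w : (s * j).-tuple T) : size (take j w) == j.
  by rewrite size_takel // size_tuple.
rewrite (reindex_onto (fun u : j.-tuple T => [tuple of flatten (nseq s (val u))])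
  (fun w => Tuple (sz w))) /=; last first.
  move=> w /eqP rw; apply: val_inj; rewrite /= -rot_periodic //.
  by rewrite size_tuple.
apply: eq_bigl => u; rewrite -[j in rot j](size_tuple u) rot_flatten_nseq eqxx /=.
apply/eqP/val_inj => /=; case: s s0 {js sz} => // s _ /=.
by rewrite -[j in take j](size_tuple u) take_size_cat.
Qed.

(** * Integrality in each degree *)

Section PerDegree.
Variables (L : fieldType) (v : L -> rat) (p : nat).
Hypothesis hv : is_valuation v.
Hypothesis hp : prime p.
Hypothesis v_nat : forall n, (0 < n)%N -> n%:R != 0 :> L /\ v n%:R = (logn p n)%:R.
(** These stand for v(h) and v(pi): [Bc] expresses that pi^i / i lies in h O_M, and [B1] that p
    does. *)
Variables (B c : rat).
Hypothesis Bc : forall i, (0 < i)%N -> B + (logn p i)%:R <= c *+ i.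
Hypothesis B1 : B <= 1.

(** Expand a = b + (a - b). The identity C(k,i) / k = C(k-1,i-1) / i trades the denominator k for i,
    and [Bc] bounds (a - b)^i / i. *)
Lemma vge_exp_sub_div a b k : (0 < k)%N -> vge v c (a - b) -> vge v 0 b ->
  vge v B ((a ^+ k - b ^+ k) / k%:R).
Proof.
move=> k0 hd hb; have [nk _] := v_nat k0.
rewrite -[in a ^+ k](subrK b a) [a - b + b]addrC; set d := a - b in hd *.
rewrite exprDn big_ord_recl /= subn0 expr0 mulr1 bin0 mulr1n [b ^+ k + _]addrC addrK.
rewrite mulr_suml; apply: vge_sum => // i _; rewrite /bump /= add1n.
have [ni vi] := v_nat (ltn0Sn i).
have -> : b ^+ (k - i.+1) * d ^+ i.+1 *+ 'C(k, i.+1) / k%:R =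
    b ^+ (k - i.+1) * 'C(k.-1, i)%:R * (d ^+ i.+1 / i.+1%:R).
  have /(congr1 (fun n => n%:R : L)) := mul_bin_diag k i; rewrite !natrM => e.
  rewrite -mulr_natr; apply: (mulIf nk); apply: (mulIf ni).
  have -> : b ^+ (k - i.+1) * d ^+ i.+1 * 'C(k, i.+1)%:R / k%:R * k%:R * i.+1%:R =
      b ^+ (k - i.+1) * d ^+ i.+1 * (i.+1%:R * 'C(k, i.+1)%:R).
    by field.
  by rewrite -e; field; rewrite addrC natr1.
apply: vgeMl => //.
  by apply: vgeMr => //; [exact: vgeX0 | exact: vge_nat].
have hdi := vgeX hv i.+1 hd.
apply: vge_le (vgeM hv hdi (vge_val v _)).
by rewrite val_inv // vi lerBrDr Bc.
Qed.

Variables (G : finGroupType) (F : {rmorphism L -> L}) (q : nat).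
Local Notation s := (p ^ q)%N.
Variables (r : grpalg L G) (chi : G -> L).
Hypothesis chiJ : forall x y, chi (x ^ y)%g = chi x.
Hypothesis chi_int : forall x, vge v 0 (chi x).
Hypothesis r_int : gvge v 0 r.
Hypothesis F_lift :
  forall w : seq G, vge v c (F (wcoef r w) - wcoef r w ^+ s).

Lemma wcoef_int w : vge v 0 (wcoef r w).
Proof. by apply: vge_prod0. Qed.

(** The exponent of p in [k] is below [q], so p divides s / k, and [B1] concludes. *)
Lemma vge_ratio k : (0 < k)%N -> ~~ (s %| k)%N -> vge v B (s%:R / k%:R).
Proof.
move=> k0; rewrite pfactor_dvdn // -ltnNge => lk.
have [nk vk] := v_nat k0; have s0 : (0 < s)%N by rewrite expn_gt0 prime_gt0.
have [ns vs] := v_nat s0.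
rewrite vge_nz ?mulf_neq0 ?invr_eq0 // val_mul ?invr_eq0 // val_inv // vs vk.
apply: le_trans B1 _; rewrite pfactorK // -natrB ?(ltnW lk) //.
by rewrite ler1n subn_gt0.
Qed.

(** Serves for all words when [s] does not divide [m], and for the words that are not [s]-th powers
    when it does. *)
Lemma vge_sum_words m (P : pred (m.-tuple G)) : (0 < m)%N ->
  (forall w, P (rot1_tuple w) = P w) ->
  (forall w, P w -> (s %| m)%N -> rot (m %/ s) w != w) ->
  vge v B (s%:R / m%:R * \sum_(w | P w) wcoef r w * chi (wprod w)).
Proof.
move=> m0 Prot hP; rewrite big_distrr /=.
apply: (@orbit_sum_closed _ _ _ (vge v B) _ _ (@rot1_tuple_inj G m)) => //.
- move=> w; rewrite wcoef_rot; congr (_ * (_ * _)).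
  by have := chi_rot1 chiJ 1 w; rewrite !expg1.
- exact: vge_0.
- by move=> x y; apply: vgeD.
move=> w Pw; have := rot1_order w; set d := fingraph.order _ w.
move=> [/dvdnP[k mkd] _ dP].
have k0 : (0 < k)%N by move: m0; rewrite mkd muln_gt0 => /andP[].
have d0 : (0 < d)%N by move: m0; rewrite mkd muln_gt0 => /andP[].
have [nk _] := v_nat k0; have [nd _] := v_nat d0.
(* Otherwise m / s is a multiple of the period [d], and rotation by it fixes [w], against [hP]. *)
have sk : ~~ (s %| k)%N.
  apply/negP => /dvdnP[j kj].
  have s0 : (0 < s)%N by rewrite expn_gt0 prime_gt0.
  have ms : m = (j * d * s)%N by rewrite mkd kj mulnAC.
  have sm : (s %| m)%N by rewrite ms dvdn_mull.
  have /negP := hP w Pw sm; case; rewrite {1}ms mulnK //.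
  have jm : (j * d <= m)%N by rewrite ms leq_pmulr.
  apply/eqP; rewrite -iter_rot1_tuple //.
  by congr val; elim: j {kj ms jm} => [|j IH] //;
     rewrite mulSn iterD IH iter_order //; exact: rot1_tuple_inj.
rewrite unfold_in -/d -/(vge v B _) -(mulr_natr _ d).
(* The orbit size cancels the factor [d] of m = k d, leaving the denominator [k]. *)
have -> : s%:R / m%:R * (wcoef r w * chi (wprod w)) * d%:R =
    s%:R / k%:R * (wcoef r w * chi (wprod w)).
  have -> : m%:R = k%:R * d%:R :> L by rewrite [in LHS]mkd natrM.
  by field; rewrite nk nd.
apply: vgeMr => //; first exact: vge_ratio.
by apply: vgeMr => //; exact: wcoef_int.
Qed.

(** If u is the k-th power of its primitive block x, its coefficient is the k-th power of that of x,
    and the orbit size reduces the denominator [j] to [k]; [vge_exp_sub_div] then applies. *)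
Lemma vge_sum_frobenius j : (0 < j)%N ->
  vge v B (j%:R^-1 * \sum_(u : j.-tuple G)
    (wcoef r u ^+ s - F (wcoef r u)) * chi (wprod u ^+ s)%g).
Proof.
move=> j0; rewrite big_distrr /=.
apply: (@orbit_sum_closed _ _ _ (vge v B) _ _ (@rot1_tuple_inj G j)) => //.
- by move=> u; rewrite wcoef_rot chi_rot1.
- exact: vge_0.
- by move=> x y; apply: vgeD.
move=> u _; have := rot1_order u; set d := fingraph.order _ u.
move=> [/dvdnP[k jkd] + _].
have k0 : (0 < k)%N by move: j0; rewrite jkd muln_gt0 => /andP[].
have d0 : (0 < d)%N by move: j0; rewrite jkd muln_gt0 => /andP[].
have [nk _] := v_nat k0; have [nd _] := v_nat d0.
have -> : (j %/ d)%N = k by rewrite [in LHS]jkd mulnK.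
move=> uE; rewrite unfold_in -/d -/(vge v B _) -(mulr_natr _ d).
set x := take d u in uE.
have -> : wcoef r u = wcoef r x ^+ k by rewrite [val u]uE wcoef_flatten_nseq.
rewrite rmorphXn exprAC.
have -> : j%:R = k%:R * d%:R :> L by rewrite [in LHS]jkd natrM.
(* The sign is changed so that the integral base of the binomial expansion is the [s]-th power, not
   the value of [F]. *)
have -> : (k%:R * d%:R)^-1 * ((wcoef r x ^+ s ^+ k - F (wcoef r x) ^+ k) *
    chi (wprod u ^+ s)%g) * d%:R =
    - ((F (wcoef r x) ^+ k - wcoef r x ^+ s ^+ k) / k%:R * chi (wprod u ^+ s)%g).
  by field; rewrite nk nd.
rewrite vgeN //; apply: vgeMr => //; apply: vge_exp_sub_div => //.
by apply: vgeX0 => //; exact: wcoef_int.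
Qed.

Lemma vge_degree_ndvd m : (0 < m)%N -> ~~ (s %| m)%N ->
  vge v B (s%:R / m%:R * gtrace chi (r ^+ m)).
Proof.
move=> m0 sm; rewrite gtrace_exp; apply: vge_sum_words => // w _.
by move=> sm'; rewrite sm' in sm.
Qed.

Lemma vge_degree_dvd j : (0 < j)%N ->
  vge v B (s%:R / (s * j)%:R * gtrace chi (r ^+ (s * j)) -
           j%:R^-1 * gtrace chi (hatF F s (r ^+ j))).
Proof.
move=> j0; have s0 : (0 < s)%N by rewrite expn_gt0 prime_gt0.
have [nj _] := v_nat j0; have [ns _] := v_nat s0.
have sj0 : (0 < s * j)%N by rewrite muln_gt0 s0.
rewrite gtrace_exp gtrace_hatF_exp.
(* Words fixed by rotation by [j] are the [s]-th powers and are paired with the second series; the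
   others are left to [vge_sum_words]. *)
rewrite (bigID (fun w : (s * j).-tuple G => rot j w == w)) /=.
have -> : \sum_(w : (s * j).-tuple G | rot j w == w) wcoef r w * chi (wprod w) =
    \sum_(u : j.-tuple G) wcoef r u ^+ s * chi (wprod u ^+ s)%g.
  rewrite (sum_rot_fixed _ (fun w : seq G => wcoef r w * chi (wprod w)) s0).
  by apply: eq_bigr => u _; rewrite wcoef_flatten_nseq wprod_flatten_nseq.
rewrite mulrDr addrAC {1}natrM invfM mulrA divff // mul1r -mulrBr -sumrB.
apply: vgeD => //.
  by under eq_bigr do rewrite -mulrBl; exact: vge_sum_frobenius.
apply: vge_sum_words => // [w|w hw _]; last by rewrite mulKn.
(* Rotations commute, so being fixed by rotation by [j] is a rotation-invariant condition. *)
rewrite /=; congr (~~ _); rewrite -(inj_eq (@rot_inj 1%N G) (rot j w)).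
by rewrite rot_rot.
Qed.

(** With these cutoffs, degree [j] of the second series meets degree s j of the first, and every
    other degree of the first is prime to being a multiple of [s]. *)
Lemma vge_partial_sum T :
  vge v B (gtrace chi (s%:R *: \sum_(1 <= m < s * T) m%:R^-1 *: r ^+ m -
    \sum_(1 <= m < T) m%:R^-1 *: hatF F s (r ^+ m))).
Proof.
have s0 : (0 < s)%N by rewrite expn_gt0 prime_gt0.
(* Fewer than [s] degrees directly after s t contain no multiple of [s]. *)
have tail t n : (n < s)%N -> vge v B
    (\sum_((s * t).+1 <= m < (s * t).+1 + n) s%:R / m%:R * gtrace chi (r ^+ m)).
  move=> ns; rewrite big_nat; apply: vge_sum => // m /andP[tm mt].
  apply: vge_degree_ndvd; first exact: leq_ltn_trans tm.
  rewrite -(subnKC (ltnW tm)) dvdn_addr ?dvdn_mulr // gtnNdvd ?subn_gt0 //.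
  by rewrite ltn_subLR ?(ltnW tm) // (leq_trans mt) // addSn ltn_add2l.
rewrite gtraceB gtraceZ !gtrace_sum big_distrr /=.
under eq_bigr do rewrite gtraceZ mulrA.
under [X in _ - X]eq_bigr do rewrite gtraceZ.
(* The sums start at 1, so both are empty for T = 0, and the induction starts at T = 1 with the
   degrees below [s]. *)
case: T => [|T]; first by rewrite muln0 !big_geq // subrr vge_0.
elim: T => [|T IH].
  rewrite muln1 [X in _ - X]big_geq // subr0 -{1}(prednK s0) -add1n.
  by have := tail 0%N s.-1; rewrite muln0 ltn_predL; apply.
rewrite [X in _ - X]big_nat_recr //= mulnS [(s + _)%N]addnC.
rewrite (@big_cat_nat _ _ _ (s * T.+1)) ?muln_gt0 ?s0 ?leq_addr //=.
have lt : (s * T.+1 < s * T.+1 + s)%N by rewrite -[X in (X < _)%N]addn0 ltn_add2l.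
rewrite (big_ltn lt).
have -> (a b d e f : L) : a + (b + d) - (e + f) = (a - e) + ((b - f) + d) by ring.
apply: vgeD => //; apply: vgeD => //; first exact: vge_degree_dvd.
by have := tail T.+1 s.-1; rewrite ltn_predL addSnnS prednK //; apply.
Qed.

End PerDegree.

(** * Convergence *)

Lemma affine_le_exp2 D b : exists k0, forall k, (k0 <= k)%N ->
  (D * (b + k) <= 2 ^ k)%N.
Proof.
(* Beyond this bound D (b + 2) <= j + 1 for j the half of k, whence D (b + k) <= (j + 1)^2 <=
   (2^j)^2 <= 2^k. *)
exists (2 * (D * (b + 2)))%N => k hk; pose j := (k %/ 2)%N.
have kj : (k <= 2 * j + 1)%N by rewrite /j; lia.
have jD : (D * (b + 2) <= j.+1)%N by rewrite /j; lia.
have : ((2 ^ j) ^ 2 <= 2 ^ k)%N by rewrite -expnM leq_exp2l // /j; lia.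
apply: leq_trans; have := ltn_expl j (ltnSn 1); nia.
Qed.

(** Linear growth beats the p-adic exponent k of i: a small k is absorbed by the size of i, and a
    large one by i >= p^k >= 2^k. *)
Lemma logn_growth p m (c B : rat) : prime p -> (0 < m)%N -> 0 < c ->
  exists n0, forall i, (n0 <= i)%N -> B + (logn p i)%:R <= c *+ (i %/ m).
Proof.
move=> hp m0 c0; have [b Bb] := rat_le_nat B; have [n cn] := rat_le_nat c^-1.
have [k0 hk0] := affine_le_exp2 (m * n) b.
exists (m * n * (b + k0)).+1 => i hi; set k := logn p i.
have key : (m * n * (b + k) <= i)%N.
  have [kk|/ltnW kk] := leqP k k0.
    by apply: leq_trans (ltnW hi); rewrite leq_mul2l leq_add2l kk orbT.
  apply: leq_trans (hk0 k kk) _; apply: (@leq_trans (p ^ k)).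
    by case: (k) => // k'; rewrite leq_exp2r // prime_gt1.
  by apply: dvdn_leq (pfactor_dvdnn p i); apply: leq_ltn_trans hi.
have {}key : (n * (b + k) <= i %/ m)%N by rewrite leq_divRL // mulnC mulnA.
apply: (@le_trans _ _ (c *+ (n * (b + k)))); last by rewrite ler_wpMn2l // ltW.
have cn1 : 1 <= c *+ n.
  by rewrite -mulr_natr -ler_pdivrMl ?mulr1.
rewrite mulrnA; apply: (@le_trans _ _ (1 *+ (b + k))).
  by rewrite natrD lerD2r.
by rewrite lerMn2r cn1 orbT.
Qed.

(** * Coordinates on conjugacy classes *)

Section ConjugacyClasses.
Variables (R : comNzRingType) (G : finGroupType).

Definition class_ind (D : conjclass G) (x : G) : R := (class_elt x == D)%:R.

Lemma class_indJ D x y : class_ind D (x ^ y)%g = class_ind D x.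
Proof.
congr (_ == _)%:R; apply: val_inj => /=.
by rewrite classGidl ?inE.
Qed.

Lemma conj_mapE (f : grpalg R G) D :
  (conj_map f : {ffun conjclass G -> R^o}) D = gtrace (class_ind D) f.
Proof.
rewrite /conj_map sum_ffunE; apply: eq_bigr => x _.
by rewrite !ffunE eq_sym.
Qed.

(** A preimage under [conj_map] carries each coordinate on the chosen representative of its class
    and is 0 elsewhere. *)
Lemma LambdaP (A : {pred R}) (z : classmod R G) : 0 \in A ->
  (forall D, (z : {ffun conjclass G -> R^o}) D \in A) -> Lambda A z.
Proof.
move=> A0 zA; pose zf : {ffun conjclass G -> R^o} := z.
pose f : grpalg R G :=
  [ffun x => if x == repr (x ^: [set: G])%g then zf (class_elt x) else 0].
have fE x : coef f x = if x == repr (x ^: [set: G])%g then zf (class_elt x) else 0.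
  by rewrite /coef ffunE.
exists f; first by apply/forallP => x; rewrite fE; case: ifP.
apply/ffunP => D; rewrite conj_mapE /gtrace.
pose x0 := repr (val D).
have x0D : (x0 ^: [set: G])%g = val D.
  have /imsetP[y _ Dy] := valP D.
  by rewrite /x0 Dy; apply/class_eqP; apply: mem_repr (class_refl _ y).
have cD : class_elt x0 = D by apply: val_inj.
rewrite (bigD1 x0) //= big1 ?addr0 => [|x xx0].
  by rewrite fE x0D eqxx cD /class_ind cD eqxx mulr1.
rewrite fE; case: eqP => [ex|_]; last by rewrite mul0r.
rewrite /class_ind; case: eqP => [eD|_]; last by rewrite mulr0.
by case/eqP: xx0; rewrite ex /x0 -eD.
Qed.

End ConjugacyClasses.

Lemma coef_hatF (R : nzRingType) (G : finGroupType) (F : R -> R) s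
    (f : grpalg R G) y :
  coef (hatF F s f) y = \sum_(x | (x ^+ s)%g == y) F (coef f x).
Proof.
rewrite grp_coef_sum [RHS]big_mkcond; apply: eq_bigr => x _.
by rewrite grp_coefZ coef_elt eq_sym; case: eqP; rewrite ?mulr1 ?mulr0.
Qed.

Section Convergence.
Variables (Qp : fieldType) (vp : Qp -> rat) (N : fieldExtType Qp) (v : N -> rat).
Variables (p : nat) (G : finGroupType) (M : {subfield N}).
Hypothesis hp : prime p.
Hypothesis hQp : is_padic_field p vp.
Hypothesis hv : is_valuation v.
Hypothesis hv_ext : forall a : Qp, a != 0 -> v (a%:A) = vp a.

Lemma v_natr n : (0 < n)%N -> n%:R != 0 :> N /\ v n%:R = (logn p n)%:R.
Proof.
have [_ hn _ _] := hQp; move=> /hn[nn vn].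
have e : n%:R = (n%:R : Qp)%:A :> N by rewrite -in_algE rmorph_nat.
by rewrite e hv_ext // vn scaler_eq0 negb_or nn oner_neq0.
Qed.

(** Limits are taken in the subspace [M], itself complete, so that the sum has its coefficients
    there. *)
Lemma grp_series_converges (u : nat -> grpalg N G) :
  (forall m x, coef (u m) x \in M) ->
  (forall B, exists n0, forall i, (n0 <= i)%N -> gvge v B (u i)) ->
  exists S, grp_series_sum v (mem M) u S.
Proof.
move=> uM uB; have [_ _ _ compl] := hQp.
have /fin_all_exists2[l lM hl] x : exists2 l, l \in M &
    vcvg v (fun k => \sum_(1 <= m < k) coef (u m) x) l.
  have := vcomplete_vspace hv hv_ext compl (U := M).
  apply=> [k|]; first by apply: rpred_sum => m _.
  apply: vcauchy_series => // B; have [n0 h] := uB B.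
  by exists n0 => i /h; apply.
exists ([ffun x => l x] : grpalg N G); split.
  by apply/forallP => x; rewrite /coef ffunE.
move=> x; rewrite {2}/coef ffunE => B; have [m hm] := hl x B.
by exists m => i /hm; rewrite grp_coef_sum.
Qed.

Variables (pi : N) (r : grpalg N G).
Hypothesis hpi : uniformizer v (mem M) pi.
Hypothesis hr : jacobson (grpalg_over (valring v (mem M))) r.

Lemma jacobson_coef m x : coef (r ^+ m) x \in M /\ vge v 0 (coef (r ^+ m) x).
Proof.
have [rA _] := hr.
have Aring := @grpalg_over_subring _ G _ (valring_subring M hv).
by have /forallP/(_ x)/valringP := subring_exp m Aring rA.
Qed.

Lemma natrV_mem n : (n%:R^-1 : N) \in M.
Proof. by rewrite rpredV rpred_nat. Qed.

Lemma log_terms_small B : exists n0, forall i, (n0 <= i)%N ->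
  gvge v B (i%:R^-1 *: r ^+ i).
Proof.
have [m m0 hm] := jacobson_nilpotent hv hpi hr.
have [n0 hn0] := logn_growth B hp m0 (val_uniformizer_gt0 hv hpi).
exists n0.+1 => i n0i; have i0 : (0 < i)%N by apply: leq_ltn_trans n0i.
have [ni vi] := v_natr i0.
(* Each full block r^m contributes one factor pi; the remaining power, of exponent i mod m, is
   integral. *)
have ri : gvge v (v pi *+ (i %/ m)) (r ^+ i).
  rewrite {2}(divn_eq i m) exprD mulnC exprM -[_ *+ _]addr0.
  apply: gvgeM => //; first exact: gvgeX.
  by move=> x; have [] := jacobson_coef (i %% m) x.
move=> x; rewrite grp_coefZ.
apply: vge_le (vgeM hv (vge_val v _) (ri x)).
by rewrite val_inv // vi addrC lerBrDr hn0 // ltnW.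
Qed.

Lemma log_series_converges :
  exists S, grp_series_sum v (mem M) (fun m => m%:R^-1 *: r ^+ m) S.
Proof.
apply: grp_series_converges => [m x|B]; last exact: log_terms_small.
by rewrite grp_coefZ rpredM ?natrV_mem //; have [] := jacobson_coef m x.
Qed.

Variables (F : {rmorphism N -> N}) (s : nat).
Hypothesis FM : forall z, z \in M -> F z \in M.
Hypothesis F_lift : forall z, z \in valring v (mem M) ->
  in_multiples (valring v (mem M)) pi (F z - z ^+ s).

Lemma lift_vge z : z \in M -> vge v 0 z -> vge v (v pi) (F z - z ^+ s).
Proof.
move=> zM zv; have [|y /valringP[_ yv] ->] := F_lift (z := z).
  exact/valringP.
by apply: vgeMr => //; apply: vge_val.
Qed.

(** Write z = p^n y with y integral. [F] fixes p^n, and F(y) is integral because it is congruent to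
    y^s modulo pi. *)
Lemma F_vge_nat n z : z \in M -> vge v n%:R z -> vge v n%:R (F z).
Proof.
move=> zM zn; have pn0 : (0 < p ^ n)%N by rewrite expn_gt0 prime_gt0.
have [npn vpn] := v_natr pn0; rewrite pfactorK // in vpn.
pose y := z / (p ^ n)%:R.
have yM : y \in M by rewrite rpredM ?natrV_mem.
have yv : vge v 0 y.
  have := vgeM hv zn (vge_val v (p ^ n)%:R^-1).
  by rewrite val_inv // vpn subrr.
have -> : z = (p ^ n)%:R * y by rewrite mulrC divfK.
rewrite rmorphM rmorph_nat -vpn; apply: vgeMr => //; first exact: vge_val.
rewrite -(subrK (y ^+ s) (F y)); apply: vgeD => //; last exact: vgeX0.
apply: vge_le (lift_vge yM yv); exact/ltW/(val_uniformizer_gt0 hv hpi).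
Qed.

Lemma hatF_series_converges :
  exists S, grp_series_sum v (mem M) (fun m => m%:R^-1 *: hatF F s (r ^+ m)) S.
Proof.
(* [F] fixes the rational 1/m, so these terms come from those of the first series by applying [F] to
   coefficients, and their smallness carries over. *)
have cE m y : coef (m%:R^-1 *: hatF F s (r ^+ m)) y =
    \sum_(x | (x ^+ s)%g == y) F (coef (m%:R^-1 *: r ^+ m) x).
  rewrite grp_coefZ coef_hatF mulr_sumr; apply: eq_bigr => x _.
  by rewrite grp_coefZ rmorphM fmorphV rmorph_nat.
have uM m x : coef (m%:R^-1 *: r ^+ m) x \in M.
  by rewrite grp_coefZ rpredM ?natrV_mem //; have [] := jacobson_coef m x.
apply: grp_series_converges => [m y|B].
  by rewrite cE rpred_sum // => x _; apply: FM.
have [b Bb] := rat_le_nat B; have [n0 hn0] := log_terms_small b%:R.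
exists n0 => i /hn0 hi y; rewrite cE; apply: vge_sum => // x _.
by apply: vge_le Bb _; apply: F_vge_nat.
Qed.

End Convergence.

(** That pi^(p^k) / p^k lies in h O_M gives the bound at i = p^k. A general i follows with k its
    p-adic exponent, as p^k <= i. *)
Lemma h_generator_val (L : fieldType) (v : L -> rat) (A : {pred L}) p (pi h : L) :
  is_valuation v -> prime p ->
  (forall n, (0 < n)%N -> n%:R != 0 :> L /\ v n%:R = (logn p n)%:R) ->
  1 \in valring v A -> pi != 0 -> 0 <= v pi -> h_generator v A p pi h ->
  h != 0 /\ forall i, (0 < i)%N -> v h + (logn p i)%:R <= v pi *+ i.
Proof.
move=> hv hp v_nat A1 npi vpi [_ hh].
have hk k : h != 0 /\ v h + k%:R <= v pi *+ (p ^ k).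
  have pk0 : (0 < p ^ k)%N by rewrite expn_gt0 prime_gt0.
  have [npk vpk] := v_nat _ pk0; rewrite pfactorK // in vpk.
  have nz : pi ^+ (p ^ k) / (p ^ k)%:R != 0.
    by rewrite mulf_neq0 ?invr_eq0 ?expf_neq0.
  have [|y /andP[_ yv] e] := (hh (pi ^+ (p ^ k) / (p ^ k)%:R)).2.
    by exists k, 1; rewrite ?mulr1.
  move: nz (e); rewrite {1}e mulf_eq0 negb_or => /andP[nh ny].
  move=> /(congr1 v); rewrite !val_mul ?invr_eq0 ?expf_neq0 // val_inv // val_exp //.
  rewrite vpk => ev; split=> //.
  by move: yv; rewrite vge_nz // => yv; rewrite -lerBrDr ev lerDl.
split=> [|i i0]; first by have [] := hk 0%N.
apply: le_trans (hk (logn p i)).2 _; rewrite ler_wpMn2l //.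
exact: dvdn_leq (pfactor_dvdnn p i).
Qed.

(** * Passage to the limit and integrality of the logarithm *)

Theorem proposition2p6
  (p : nat) (hp : prime p)
  (G : finGroupType) (n : nat) (hn : #|G| = n)
  (Qp : fieldType) (vp : Qp -> rat) (hQp : is_padic_field p vp)
  (N : splittingFieldType Qp) (v : N -> rat) (hv : is_valuation v)
  (hv_ext : forall a : Qp, a != 0 -> v (a%:A) = vp a)
  (hN : galois 1%AS {:N}%AS)
  (hroots : exists zs : seq N, 'X^n - 1 = \prod_(z <- zs) ('X - z%:P))
  (K M : {subfield N}) (hKM : (K <= M)%VS) (hgal : galois K M)
  (q : nat) (hq : residue_field_card v (mem K) (p ^ q))
  (pi h : N) (hpi : uniformizer v (mem M) pi)
  (hh : h_generator v (mem M) p pi h)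
  (F : gal_of M) (hF : F \in 'Gal(M / K)%g)
  (hFlift : forall z, z \in valring v (mem M) ->
     in_multiples (valring v (mem M)) pi (F z - z ^+ (p ^ q)))
  (r : grpalg N G) (hr : jacobson (grpalg_over (valring v (mem M))) r) :
  exists l : grpalg N G,
    is_LF0 v (mem M) F (p ^ q) r l /\
    exists2 z : classmod N G,
      Lambda (valring v (mem M)) z & conj_map l = h *: z.
Proof.
have [_ npi _] := hpi; have [hM _] := hh.
have vpi := val_uniformizer_gt0 hv hpi.
have v_nat n0 : (0 < n0)%N -> n0%:R != 0 :> N /\ v n0%:R = (logn p n0)%:R.
  exact: v_natr hQp hv_ext n0.
have [O1 OB _] := valring_subring M hv.
have O0 : 0 \in valring v (mem M) by rewrite -[0](subrr 1); apply: OB.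
have [nh hB] := h_generator_val hv hp v_nat O1 npi (ltW vpi) hh.
(* The case i = 1 of [hB] gives v(h) <= v(pi), and p lies in the maximal ideal, so v(pi) <= v(p) =
   1. *)
have vh1 : v h <= 1.
  have := hB 1%N isT; rewrite logn1 addr0 mulr1n => /le_trans; apply.
  have [np vp1] := v_nat p (prime_gt0 hp); rewrite logn_prime // eqxx in vp1.
  have : vge v (v pi) p%:R.
    by apply: (valmax_vge hv hpi); rewrite ?rpred_nat // /vgt vp1 ltr01 orbT.
  by rewrite vge_nz // vp1.
pose Fm : {rmorphism N -> N} := F.
have FM z : z \in M -> Fm z \in M by apply: memv_gal.
have [S1 hS1] := log_series_converges hp hQp hv hv_ext hpi hr.
have [S2 hS2] := hatF_series_converges hp hQp hv hv_ext hpi hr FM hFlift.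
set s := (p ^ q)%N in hFlift hS2 *.
pose l : grpalg N G := s%:R *: S1 - S2.
have lM x : coef l x \in M.
  case: hS1 hS2 => /forallP/(_ x) S1M _ [/forallP/(_ x) S2M _].
  by rewrite grp_coefB grp_coefZ rpredB // rpredM ?rpred_nat.
have jc := jacobson_coef hv hr.
have r_int : gvge v 0 r by move=> x; have [_] := jc 1%N x; rewrite expr1.
have r_mem x : coef r x \in M by have [] := jc 1%N x; rewrite expr1.
have lift (w : seq G) : vge v (v pi) (Fm (wcoef r w) - wcoef r w ^+ s).
  apply: (lift_vge (F := Fm) hv hFlift); first by apply: rpred_prod.
  by apply: vge_prod0.
(* Each coordinate of c(l) is a limit of coordinates of the truncated differences [u T], and their
   common lower bound passes to the limit. *)
have hl D : vge v (v h) (gtrace (class_ind N D) l).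
  pose u T : grpalg N G := s%:R *: (\sum_(1 <= m < s * T) m%:R^-1 *: r ^+ m) -
    \sum_(1 <= m < T) m%:R^-1 *: hatF Fm s (r ^+ m).
  apply: (vge_closed_lim hv (u := fun T => gtrace (class_ind N D) (u T))).
    apply: vcvg_sum => // x.
    have cx : vcvg v (fun T => coef (u T) x) (coef l x).
      have e T : coef (u T) x =
          s%:R * coef (\sum_(1 <= m < s * T) m%:R^-1 *: r ^+ m) x +
          -1 * coef (\sum_(1 <= m < T) m%:R^-1 *: hatF Fm s (r ^+ m)) x.
        by rewrite grp_coefB grp_coefZ mulN1r.
      have -> : coef l x = s%:R * coef S1 x + -1 * coef S2 x.
        by rewrite grp_coefB grp_coefZ mulN1r.
      have [[_ c1] [_ c2]] := (hS1, hS2).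
      (* The cutoffs s T form a subsequence with s T >= T, so the limit is unchanged. *)
      have c1s : vcvg v
          (fun T => s%:R * coef (\sum_(1 <= m < s * T) m%:R^-1 *: r ^+ m) x)
          (s%:R * coef S1 x).
        apply: vcvgMl => //.
        apply: (vcvg_comp (f := fun T => (s * T)%N)) (c1 x) => T.
        by rewrite leq_pmull // expn_gt0 prime_gt0.
      move=> C; have [m hm] := vcvgD hv c1s (vcvgMl hv (-1) (c2 x)) C.
      by exists m => i /hm; rewrite e.
    have := vcvgMl hv (class_ind N D x) cx.
    move=> h1 C; have [m hm] := h1 C; exists m => i /hm.
    by rewrite ![class_ind N D x * _]mulrC.
  move=> T; apply: (vge_partial_sum (F := Fm) hv hp v_nat hB vh1 _ _ r_int lift T).
    by move=> x y; apply: class_indJ.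
  by move=> x; apply: vge_nat.
exists l; split; first by exists S1, S2; split.
(* The witness is c(l) divided by [h], integral in each coordinate by [hl]. *)
pose z : {ffun conjclass G -> N^o} := [ffun D => gtrace (class_ind N D) l / h].
exists z.
  apply: LambdaP => // D; rewrite ffunE; apply/valringP; split.
    rewrite rpredM ?rpredV //; apply: rpred_sum => x _.
    by rewrite rpredM ?rpred_nat.
  have := vgeM hv (hl D) (vge_val v h^-1).
  by rewrite val_inv // subrr.
apply/ffunP => D; rewrite conj_mapE [RHS]ffunE /= ffunE.
by rewrite /GRing.scale /= mulrC divfK.
Qed.
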